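(* Let $\psi:\mathbb{T}^2\to\mathbb{R}$ be a non-constant real eigenfunction of the Laplacian on the flat two-dimensional torus $\mathbb{T}^2$. Then the distribution function $$d\lambda(s)=d\operatorname{vol}(\{x\in\mathbb{T}^2:\psi(x)>s\})$$ is symmetric around $s=0$.
   Context: $\mathbb{T}^2=\mathbb{R}^2/\mathbb{Z}^2$ is the standard flat torus and $\operatorname{vol}$ is Lebesgue measure on it. A real eigenfunction is a smooth function $\psi:\mathbb{T}^2\to\mathbb{R}$, not identically zero, with $-\Delta\psi=\mu\psi$ for some real $\mu$; equivalently, for some integer $\lambda\ge 0$, $\psi$ is a real-valued linear combination of the exponentials $\exp(2\pi i(\nu_1x+\nu_2y))$ with $\nu\in\mathbb{Z}^2$, $\nu_1^2+\nu_2^2=\lambda$. The distribution function $d\lambda$ is the Stieltjes measure of $s\mapsto\operatorname{vol}(\{\psi>s\})$; that it is symmetric around $s=0$ means that it is invariant under $s\mapsto -s$, i.e. $\operatorname{vol}(\{\psi>s\})=\operatorname{vol}(\{\psi<-s\})$ for every $s\in\mathbb{R}$. *)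

(* Defs.v *)
From HB Require Import structures.
From mathcomp Require Import all_boot all_order all_algebra.
From mathcomp Require Import all_classical all_reals all_analysis.

Set Implicit Arguments.
Unset Strict Implicit.
Unset Printing Implicit Defensive.
Import Order.TTheory GRing.Theory Num.Theory.
Import numFieldNormedType.Exports.
Local Open Scope classical_set_scope.
Local Open Scope ring_scope.

(* Functions on the torus R^2/Z^2 are represented by their lifts to R^2, that
   is, by the functions R * R -> R that are invariant under translation by Z^2.
   Smoothness and the Laplacian on the flat torus are those of the lift, and
   the volume is Lebesgue measure on the fundamental domain [0, 1[ x [0, 1[. *)

Section smooth_functions_on_the_torus.
Context {R : realType}.
Implicit Type f : R * R -> R.

Definition Z2_periodic f :=
  forall (x y : R) (m n : int), f (x + m%:~R, y + n%:~R) = f (x, y).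

Definition pderiv1 f : R * R -> R := 'D_((1, 0) : R * R) f.
Definition pderiv2 f : R * R -> R := 'D_((0, 1) : R * R) f.

Fixpoint class_C (k : nat) f : Prop :=
  continuous f /\
  if k is k'.+1 then
    [/\ forall p, derivable f p ((1, 0) : R * R),
        forall p, derivable f p ((0, 1) : R * R),
        class_C k' (pderiv1 f) & class_C k' (pderiv2 f)]
  else True.

Definition smooth f := forall k, class_C k f.

Definition laplacian f : R * R -> R :=
  fun p => pderiv1 (pderiv1 f) p + pderiv2 (pderiv2 f) p.

Record torus_smooth := TorusSmooth {
  torus_fun :> R * R -> R;
  torus_fun_periodic : Z2_periodic torus_fun;
  torus_fun_smooth : smooth torus_fun }.

Definition real_eigenfunction (psi : torus_smooth) :=
  (exists p, psi p != 0) /\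
  exists mu : R, forall p, - laplacian psi p = mu * psi p.

End smooth_functions_on_the_torus.
Arguments torus_smooth : clear implicits.

Section torus_volume.
Variable R : realType.

Definition plane := (measurableTypeR R * measurableTypeR R)%type.
HB.instance Definition _ := Measurable.on plane.

Definition unit_square : set plane := `[0, 1[%classic `*` `[0, 1[%classic.

Lemma measurable_unit_square : measurable unit_square.
Proof. by apply: measurableX; exact: measurable_itv. Qed.

Definition torus_vol : set plane -> \bar R :=
  mrestr (lebesgue_measure \x lebesgue_measure)%E measurable_unit_square.

HB.instance Definition _ := Measure.on torus_vol.

Lemma torus_volT : torus_vol [set: plane] = 1%E.
Proof.
have I1 : lebesgue_measure `[0 : R, 1[%classic = 1%E.
  by rewrite lebesgue_measure_itv /= lte_fin ltr01 oppr0 adde0.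
rewrite /torus_vol /mrestr setTI product_measure1E; try exact: measurable_itv.
by transitivity (1 * 1 : \bar R)%E; [congr (_ * _)%E; exact: I1|rewrite mule1].
Qed.

HB.instance Definition _ :=
  Measure_isProbability.Build _ _ _ torus_vol torus_volT.

Lemma open_measurable_plane (U : set (R * R)) :
  open U -> measurable (U : set plane).
Proof.
move=> oU.
pose box (q : rat * rat * rat) : set plane :=
  ball (ratr q.1.1 : R) (ratr q.2 : R) `*` ball (ratr q.1.2 : R) (ratr q.2 : R).
pose F q := if pselect (box q `<=` U) then box q else set0.
have -> : U = \bigcup_q F q.
  apply/seteqP; split => [[x y] Uxy | p [q _]]; last first.
    by rewrite /F; case: pselect => // sub /sub.
  have := oU; rewrite openE => /(_ _ Uxy) /nbhs_ballP [e /= e0 sU].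
  have e2 : 0 < e / 2 by rewrite divr_gt0.
  have [r /[!in_itv]/= /andP[r0 re]] := rat_in_itvoo e2.
  have bx z : exists q : rat, ball (ratr q : R) (ratr r) z.
    have : z - ratr r < z by rewrite ltrBlDr ltrDl.
    move=> /rat_in_itvoo[q /[!in_itv]/= /andP[q1 q2]]; exists q.
    by rewrite /ball /= distrC ger0_norm ?subr_ge0 ?ltW// ltrBlDr addrC -ltrBlDr.
  have [[qx hx] [qy hy]] := (bx x, bx y).
  exists (qx, qy, r) => //; rewrite /F; case: pselect => [? | nsub]; first by split.
  exfalso; apply: nsub.
  move=> [u v] [hu hv]; apply: sU.
  have tri (q z w : R) : ball q (ratr r) z -> ball q (ratr r) w -> ball z e w.
    move=> /(le_ball (ltW re))/ball_sym qz /(le_ball (ltW re)) qw.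
    by rewrite [e]splitr; exact: ball_triangle qz qw.
  by split; [exact: tri hx hu|exact: tri hy hv].
apply: countable_bigcupT_measurable; first exact: countableP.
move=> q; rewrite /F; case: pselect => [?|?]; last exact: measurable0.
by apply: measurableX; exact: measurable_realfun.measurable_ball.
Qed.

Lemma torus_smooth_measurable (psi : torus_smooth R) :
  measurable_fun [set: plane] (psi : plane -> R).
Proof.
have /continuousP cpsi : continuous psi := proj1 (torus_fun_smooth psi 0%N).
apply: (measurability _ (measurable_realfun.RGenOpens.measurableE R)).
move=> _ [_ [a [b ->] <-]]; rewrite setTI.
apply: open_measurable_plane; apply: cpsi; exact: interval_open.
Qed.

HB.instance Definition _ (psi : torus_smooth R) :=
  isMeasurableFun.Build _ _ plane R (torus_fun psi : plane -> R)
    (torus_smooth_measurable psi).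

Definition distribution_function (psi : torus_smooth R) (s : R) : \bar R :=
  torus_vol [set p | s < psi p].

Definition opp_distribution_function psi (s : R) : R :=
  - fine (distribution_function psi s).

Lemma distribution_function_ccdf psi s :
  distribution_function psi s =
  ccdf ((torus_fun psi : {mfun plane >-> R}) : {RV torus_vol >-> R}) s.
Proof.
rewrite /ccdf /distribution /pushforward; congr (torus_vol _).
by apply/seteqP; split => p /=; rewrite in_itv/= andbT.
Qed.

Lemma opp_distribution_function_nd psi :
  nondecreasing (opp_distribution_function psi).
Proof.
move=> s t st; rewrite lerN2 !distribution_function_ccdf.
by rewrite fine_le ?fin_num_measure// ccdf_nonincreasing.
Qed.

Lemma opp_distribution_function_rc psi :
  right_continuous (opp_distribution_function psi).
Proof.
move=> s; apply: cvgN; apply: fine_cvg.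
rewrite (funext (distribution_function_ccdf psi)) fineK ?fin_num_measure//.
exact: ccdf_right_continuous.
Qed.

HB.instance Definition _ psi :=
  isCumulative.Build R _ R (opp_distribution_function psi)
    (@opp_distribution_function_nd psi) (@opp_distribution_function_rc psi).

(* lebesgue_stieltjes_measure is only available for nondecreasing functions and
   the distribution function is nonincreasing, whence the two sign changes:
   dlambda is the (nonpositive) Stieltjes measure of distribution_function. *)
Definition dlambda (psi : torus_smooth R) (A : set (measurableTypeR R)) :
    \bar R :=
  (- lebesgue_stieltjes_measure (opp_distribution_function psi) A)%E.

End torus_volume.

Definition symmetric_around0 (R : realType)
    (nu : set (measurableTypeR R) -> \bar R) :=
  forall A : set (measurableTypeR R), measurable A ->
    nu ((-%R : R -> R) @^-1` A) = nu A.

(* Main.v *)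
From HB Require Import structures.
Require Import Defs.
From mathcomp Require Import all_boot all_order all_algebra.
From mathcomp Require Import all_classical all_reals all_analysis.
From mathcomp Require Import measurable_realfun.
From mathcomp Require Import ring lra zify.
Import Order.TTheory GRing.Theory Num.Theory.
Import numFieldNormedType.Exports.
Local Open Scope classical_set_scope.
Local Open Scope ring_scope.

(** An eigenfunction [psi] is antiperiodic: some translation [s] of the torus
    satisfies [psi (p + s) = - psi p]. As translations preserve the volume,
    [psi] and [- psi] then have the same distribution.

    The vector [s] comes from arithmetic. The nonzero Fourier coefficients of
    [psi] sit at the lattice points [(k, l)] of one circle [k^2 + l^2 = n], with
    [n > 0] since [psi] is not constant, and it suffices that [k s1 + l s2] is a
    half-integer at all of them. If [n] is odd, [k + l] is odd and
    [s = (1/2, 1/2)] works; if [n] is 2 modulo 4, [k] and [l] are odd and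
    [s = (1/2, 0)] works; if 4 divides [n], [k] and [l] are even and half of a
    solution for [n / 4] works ([half_period]).

    The coefficients are handled through the real plane waves
    [cos (2 pi (k x + l y) + c)]. Integrating by parts twice in each variable
    confines those of [psi] to a circle ([eigenfunction_coef]), so all
    coefficients of [psi (p + s) + psi p] vanish, and a continuous function on
    the torus with this property is zero ([fourier_null_eq0]). The latter is
    proved by testing the function, translated so that a point where it is
    positive becomes the centre of the unit square, against the powers of
    [sin (pi x) ^ 2 * sin (pi y) ^ 2], which are trigonometric polynomials
    concentrating at that centre. *)

(** * Arithmetic of lattice points on a circle *)

(** A vector [t] for which [k t.1 + l t.2] is a half-integer at every lattice
    point [(k, l)] of norm [n]. *)
Lemma half_period (R : realType) (n : nat) : (0 < n)%N ->
  exists t : R * R, forall k l : int, k ^+ 2 + l ^+ 2 = n%:Z ->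
    exists z : int, k%:~R * t.1 + l%:~R * t.2 = z%:~R + 2^-1.
Proof.
have two0 : (2 : R) != 0 by rewrite pnatr_eq0.
elim/ltn_ind: n => n IH n0.
have par (k : int) : exists a : int, k = 2 * a \/ k = 2 * a + 1.
  exists (k %/ 2)%Z; lia.
(* When 4 divides [n], [k] and [l] are even; a sum of two squares of which one
   is odd is not divisible by 4. *)
have [m4 | n4] := boolP (4 %| n)%N.
  have [|//|t ht] := IH (n %/ 4)%N; [lia|lia|].
  exists (t.1 / 2, t.2 / 2) => k l kl.
  have [[a [ka|ka]] [b [lb|lb]]] := (par k, par l); subst k l; last 3 first.
  - exfalso; have [[c [e|e]] [d [f|f]]] := (par a, par b); subst a b; nia.
  - exfalso; have [[c [e|e]] [d [f|f]]] := (par a, par b); subst a b; nia.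
  - exfalso; have [[c [e|e]] [d [f|f]]] := (par a, par b); subst a b; nia.
  have [|z hz] := ht a b; first nia.
  by exists z; rewrite -hz /= !intrM; field.
(* Otherwise the parities of [k] and [l] are decided by [n] modulo 4. *)
have [odn | evn] := boolP (odd n).
  exists (2^-1, 2^-1) => k l kl.
  have [[a [ka|ka]] [b [lb|lb]]] := (par k, par l); subst k l.
  - exfalso; nia.
  - by exists (a + b) => /=; rewrite !(intrD, intrM); field.
  - by exists (a + b) => /=; rewrite !(intrD, intrM); field.
  - exfalso; nia.
exists (2^-1, 0) => k l kl.
have [[a [ka|ka]] [b [lb|lb]]] := (par k, par l); subst k l.
- exfalso; nia.
- exfalso; nia.
- exfalso; nia.
- by exists a => /=; rewrite !(intrD, intrM); field.
Qed.

(** * The torus volume and its translation invariance *)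

(** Lebesgue measure on the circle [R/Z], seen as the interval [0, 1[. *)
Definition circle_vol (R : realType) : set (measurableTypeR R) -> \bar R :=
  mrestr (@lebesgue_measure R)
    (measurable_itv `[0, 1[ :
      measurable (`[0, 1[%classic : set (measurableTypeR R))).

HB.instance Definition _ (R : realType) := Measure.on (circle_vol R).

Lemma circle_volE {R : realType} (A : set R) :
  circle_vol R A = lebesgue_measure (A `&` `[0, 1[).
Proof. by []. Qed.

Lemma circle_volT (R : realType) : circle_vol R [set: R] = 1%E.
Proof.
rewrite circle_volE setTI.
by rewrite lebesgue_measure_itv /= lte_fin ltr01 oppr0 adde0.
Qed.

HB.instance Definition _ (R : realType) :=
  Measure_isProbability.Build _ _ _ (circle_vol R) (@circle_volT R).

Lemma lebesgue_measure_translate {R : realType} (t : R) (A : set R) :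
  measurable A -> lebesgue_measure [set x | A (x + t)] = lebesgue_measure A.
Proof.
move=> mA.
have mt : measurable_fun [set: measurableTypeR R]
    ((fun x => x + t) : measurableTypeR R -> measurableTypeR R).
  exact: measurable_funD.
pose nu : {measure set (measurableTypeR R) -> \bar R} :=
  measure_function_pushforward__canonical__measure_function_Measure
    lebesgue_measure mt.
rewrite [RHS](@lebesgue_measure_unique R nu) ?/nu//= => _ [[a b] _ <-] /=.
rewrite /pushforward.
have -> : (fun x : R => x + t) @^-1` `]a, b]%classic = `]a - t, b - t]%classic.
  by apply/seteqP; split => x /=; rewrite !in_itv /= ltrBlDr lerBrDr.
rewrite !lebesgue_measure_itv /= !lte_fin ltrD2r; case: ifP => // _.
by congr (_%:E); ring.
Qed.

(** Translation of the circle by [s], for [0 <= s < 1], as a map that preserves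
    [0, 1[; on the whole line it agrees with [x + s] up to an integer. *)
Definition rotate {R : realType} (s x : R) : R :=
  if x < 1 - s then x + s else x + (s - 1).

Lemma measurable_rotate {R : realType} (s : R) :
  measurable_fun [set: measurableTypeR R]
    (rotate s : measurableTypeR R -> measurableTypeR R).
Proof.
apply: measurable_fun_ifT; [|exact: measurable_funD|exact: measurable_funD].
exact: measurable_fun_ltr.
Qed.

Lemma circle_vol_rotate {R : realType} (s : R) (A : set (measurableTypeR R)) :
  0 <= s < 1 -> measurable A ->
  circle_vol R (rotate s @^-1` A) = circle_vol R A.
Proof.
move=> /andP[s0 s1] mA; rewrite !circle_volE.
have mI (a b : R) : measurable (A `&` `[a, b[%classic).
  by apply: measurableI => //; exact: measurable_itv.
(* The circle is cut at [s] in the image, that is, at [1 - s] in the source. *)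
have -> : A `&` `[0, 1[%classic = (A `&` `[s, 1[) `|` (A `&` `[0, s[).
  rewrite -setIUr; congr (_ `&` _); apply/seteqP.
  split => x /=; rewrite !in_itv /=.
    move=> /andP[x0 x1].
    by case: (leP s x) => sx; [left; rewrite x1|right; rewrite x0].
  by move=> [|] /andP[? ?]; apply/andP; split; lra.
have -> : (rotate s @^-1` A) `&` `[0, 1[ =
    [set x | (A `&` `[s, 1[) (x + s)] `|`
    [set x | (A `&` `[0, s[) (x + (s - 1))].
  rewrite /rotate; apply/seteqP; split => x /=; rewrite !in_itv /=.
    move=> []; case: ltP => xs Ax /andP[x0 x1]; [left|right]; split => //; lra.
  by move=> [|] [Ax /andP[? ?]]; (split; [|lra]); case: ltP => // ?; lra.
have mpre (t : R) (B : set (measurableTypeR R)) : measurable B ->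
    measurable ([set x | B (x + t)] : set (measurableTypeR R)).
  move=> mB; have /(_ measurableT _ mB) : measurable_fun [set: measurableTypeR R]
    ((fun x => x + t) : measurableTypeR R -> measurableTypeR R).
    exact: measurable_funD.
  by rewrite setTI.
rewrite !measureU//.
- congr (_ + _)%E.
    by have := @lebesgue_measure_translate R s (A `&` `[s, 1[) (mI _ _).
  by have := @lebesgue_measure_translate R (s - 1) (A `&` `[0, s[) (mI _ _).
- apply/seteqP; split => x //= [[_]] + [_]; rewrite !in_itv /=.
  by move=> /andP[? ?] /andP[? ?]; lra.
- exact: mpre.
- exact: mpre.
- apply/seteqP; split => x //= [[_]] + [_]; rewrite !in_itv /=.
  by move=> /andP[? ?] /andP[? ?]; lra.
Qed.

Lemma torus_volE {R : realType} (A : set (plane R)) : measurable A ->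
  torus_vol A = (circle_vol R \x circle_vol R)%E A.
Proof.
move=> mA; apply/esym; apply: product_measure_unique => // B C mB mC.
rewrite /= /torus_vol /mrestr /unit_square -setXI.
rewrite product_measure1E//; apply: measurableI => //; exact: measurable_itv.
Qed.

(** Translation of the torus, preserving the unit square. *)
Definition torus_rotate {R : realType} (s : R * R) (p : plane R) : plane R :=
  (rotate s.1 p.1, rotate s.2 p.2).

Lemma measurable_torus_rotate {R : realType} (s : R * R) :
  measurable_fun [set: plane R] (torus_rotate s).
Proof.
by apply: measurable_fun_pair;
  (apply: measurableT_comp; first exact: measurable_rotate).
Qed.

Lemma torus_vol_rotate {R : realType} (s : R * R) (A : set (plane R)) :
  0 <= s.1 < 1 -> 0 <= s.2 < 1 -> measurable A ->
  torus_vol (torus_rotate s @^-1` A) = torus_vol A.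
Proof.
move=> s1 s2 mA.
pose nu : {measure set (plane R) -> \bar R} :=
  measure_function_pushforward__canonical__measure_function_Measure
    (@torus_vol R) (measurable_torus_rotate s).
rewrite [RHS]torus_volE// (@product_measure_unique _ _ _ _ _ _ _ nu)//.
move=> B C mB mC; rewrite /nu /= /pushforward.
have -> : torus_rotate s @^-1` (B `*` C) =
    (rotate s.1 @^-1` B) `*` (rotate s.2 @^-1` C) by [].
have mrot t D : measurable D -> measurable (rotate t @^-1` D).
  by move=> mD; have := measurable_rotate t measurableT D mD; rewrite setTI.
rewrite torus_volE; last by apply: measurableX; exact: mrot.
rewrite product_measure1E; [|exact: mrot|exact: mrot].
by congr (_ * _)%E; exact: circle_vol_rotate.
Qed.

(** * Integration of continuous functions on the torus *)

(** Continuous functions on the torus, represented by their lifts. *)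
Definition torus_continuous {R : realType} (f : R * R -> R) :=
  continuous f /\ Z2_periodic f.

(** The integral over the torus. *)
Definition torus_int {R : realType} (f : R * R -> R) : R :=
  (\int[@torus_vol R]_p (f : plane R -> R) p)%R.

Lemma continuous_measurable_plane {R : realType} (f : R * R -> R) :
  continuous f -> measurable_fun [set: plane R] (f : plane R -> R).
Proof.
move=> /continuousP cf.
apply: (measurability _ (RGenOpens.measurableE R)).
move=> _ [_ [a [b ->] <-]]; rewrite setTI.
by apply: open_measurable_plane; apply: cf; exact: interval_open.
Qed.

Lemma int_add_frac {R : realType} (x : R) :
  exists (n : int) (y : R), x = y + n%:~R /\ 0 <= y < 1.
Proof.
exists (Num.floor x), (x - (Num.floor x)%:~R); split; first by rewrite subrK.
by have := floor_itv x; rewrite intrD => /andP[? ?]; lra.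
Qed.

Lemma torus_continuous_bounded {R : realType} (f : R * R -> R) :
  torus_continuous f -> exists M, forall p, `|f p| <= M.
Proof.
move=> [cf pf].
have cK : compact (`[0, 1]%classic `*` `[0, 1]%classic : set (R * R)).
  by apply: compact_setX; exact: segment_compact.
have : compact (f @` (`[0, 1]%classic `*` `[0, 1]%classic)).
  by apply: continuous_compact => //; apply: continuous_subspaceT.
move=> /compact_bounded [M [_ hM]]; exists (M + 1) => -[x y].
have [n [u [-> /andP[u0 u1]]]] := int_add_frac x.
have [m [v [-> /andP[v0 v1]]]] := int_add_frac y.
rewrite pf; apply: (hM (M + 1)); first by rewrite ltrDl.
by exists (u, v) => //; split; rewrite /= in_itv /= ?u0 ?v0 ltW.
Qed.

Lemma torus_continuous_integrable {R : realType} (f : R * R -> R) :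
  torus_continuous f ->
  (@torus_vol R).-integrable [set: plane R] (EFin \o (f : plane R -> R)).
Proof.
move=> tf; apply: measurable_bounded_integrable => //.
- by rewrite -ge0_fin_numE// fin_num_measure.
- exact: continuous_measurable_plane (proj1 tf).
- have [M hM] := torus_continuous_bounded f tf.
  exists M; split; first exact: num_real.
  by move=> x Mx p _; exact: le_trans (hM p) (ltW Mx).
Qed.

Lemma torus_continuous_cst {R : realType} (c : R) :
  torus_continuous (fun=> c).
Proof. by split => // p; exact: cvg_cst. Qed.

Lemma torus_continuousD {R : realType} (f g : R * R -> R) :
  torus_continuous f -> torus_continuous g ->
  torus_continuous (fun p => f p + g p).
Proof.
move=> [cf pf] [cg pg]; split=> [p|x y m n]; last by rewrite pf pg.
by apply: (@continuousD _ _ _ f g); [exact: cf|exact: cg].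
Qed.

Lemma torus_continuousM {R : realType} (f g : R * R -> R) :
  torus_continuous f -> torus_continuous g ->
  torus_continuous (fun p => f p * g p).
Proof.
move=> [cf pf] [cg pg]; split=> [p|x y m n]; last by rewrite pf pg.
by apply: (@continuousM _ _ f g); [exact: cf|exact: cg].
Qed.

Lemma torus_continuous_translate {R : realType} (f : R * R -> R) (s : R * R) :
  torus_continuous f ->
  torus_continuous (fun p => f (p.1 + s.1, p.2 + s.2)).
Proof.
move=> [cf pf]; split=> [p|x y m n]; last by rewrite /= addrAC (addrAC y) pf.
apply: (@continuous_comp _ _ _ (fun p : R * R => p + s) f); last exact: cf.
by apply: cvgD; [exact: cvg_id|exact: cvg_cst].
Qed.

Lemma torus_intD {R : realType} (f g : R * R -> R) :
  torus_continuous f -> torus_continuous g ->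
  torus_int (fun p => f p + g p) = torus_int f + torus_int g.
Proof.
by move=> cf cg; apply: RintegralD => //; exact: torus_continuous_integrable.
Qed.

Lemma torus_intZ {R : realType} (c : R) (f : R * R -> R) :
  torus_continuous f -> torus_int (fun p => c * f p) = c * torus_int f.
Proof.
by move=> cf; apply: RintegralZl => //; exact: torus_continuous_integrable.
Qed.

Lemma torus_int_cst {R : realType} (c : R) : torus_int (fun=> c) = c.
Proof.
by rewrite /torus_int Rintegral_cst//= torus_volT /= mulr1.
Qed.

(** On periodic functions, every translation acts as a [torus_rotate]. *)
Lemma translate_rotate {R : realType} (s : R * R) :
  exists2 t : R * R, 0 <= t.1 < 1 /\ 0 <= t.2 < 1 &
    forall f, Z2_periodic f ->
      forall p, f (p.1 + s.1, p.2 + s.2) = f (torus_rotate t p) :> R.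
Proof.
have [m [u [su u01]]] := int_add_frac s.1.
have [n [v [sv v01]]] := int_add_frac s.2.
exists (u, v) => // f pf p.
rewrite /torus_rotate /rotate /= su sv !addrA pf.
have per1 x y : f (x - 1, y) = f (x, y).
  by rewrite -[RHS](pf x y (-1) 0) intrN addr0.
have per2 x y : f (x, y - 1) = f (x, y).
  by rewrite -[RHS](pf x y 0 (-1)) intrN addr0.
by case: ifP; case: ifP; rewrite ?addrA ?per1 ?per2.
Qed.

Lemma torus_int_translate {R : realType} (f : R * R -> R) (s : R * R) :
  torus_continuous f ->
  torus_int (fun p => f (p.1 + s.1, p.2 + s.2)) = torus_int f.
Proof.
move=> tf.
have [t [t1 t2] ft] := translate_rotate s.
have fE := ft f (proj2 tf).
rewrite /torus_int /Rintegral; congr fine.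
under eq_integral do rewrite fE.
have mr := measurable_torus_rotate t.
have mf : measurable_fun [set: plane R] (EFin \o (f : plane R -> R)).
  apply/measurable_EFinP; exact: continuous_measurable_plane (proj1 tf).
have tfi : (@torus_vol R).-integrable (torus_rotate t @^-1` [set: plane R])
    ((EFin \o (f : plane R -> R)) \o torus_rotate t).
  rewrite preimage_setT.
  have -> : (EFin \o f) \o torus_rotate t =
      EFin \o (fun p : plane R => f (p.1 + s.1, p.2 + s.2)).
    by apply/funext => p /=; rewrite fE.
  apply: torus_continuous_integrable; exact: torus_continuous_translate.
have := integral_pushforward mr mf tfi measurableT.
rewrite preimage_setT => <-.
apply: eq_measure_integral => A mA _.
by rewrite /= /pushforward torus_vol_rotate.
Qed.

(** A measure carried by [D] only sees the integral over [D]. *)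
Lemma integral_conull d (T : measurableType d) (R : realType)
    (mu : {measure set T -> \bar R}) (D : set T) (f : T -> \bar R) :
  measurable D -> mu (~` D) = 0%E -> measurable_fun [set: T] f ->
  (\int[mu]_x f x = \int[mu]_(x in D) f x)%E.
Proof.
move=> mD D0 mf; have mDC : measurable (~` D) by exact: measurableC.
rewrite -(setUv D) integral_setU//; last 2 first.
- by rewrite setUv.
- by rewrite disj_set2E setICr.
by rewrite (null_set_integral mDC _ D0) ?adde0//; exact: measurable_funTS.
Qed.

Lemma circle_integralE {R : realType} (g : R -> R) : continuous g ->
  (\int[circle_vol R]_x (g x)%:E =
   \int[lebesgue_measure]_(x in `[0%R, 1%R]) (g x)%:E)%E.
Proof.
move=> cg.
have mg : measurable_fun [set: measurableTypeR R]
    (EFin \o (g : measurableTypeR R -> R)).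
  by apply/measurable_EFinP; exact: continuous_measurable_fun.
have mI : measurable (`[0, 1[%classic : set (measurableTypeR R)).
  exact: measurable_itv.
rewrite -integral_itv_bndo_bndc; last exact: measurable_funTS.
rewrite (@integral_conull _ _ _ (circle_vol R) `[0, 1[%classic)//; last first.
  by rewrite /= circle_volE setICl measure0.
by apply: eq_measure_integral => A mA A01; rewrite /= circle_volE setIidl.
Qed.

(** A lower bound that is only required on the unit square. *)
Lemma torus_int_le {R : realType} (f : R * R -> R) (a b : R)
    (V : set (plane R)) :
  torus_continuous f -> measurable V ->
  (forall p, unit_square p -> a * \1_V p + b <= f p) ->
  a * fine (torus_vol V) + b <= torus_int f.
Proof.
move=> tf mV h.
have fi := torus_continuous_integrable f tf.
have mU := @measurable_unit_square R.
have oneVi := @integrable_indic _ _ _ (@torus_vol R) _ mV.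
have Vi : (@torus_vol R).-integrable [set: plane R]
    (EFin \o (fun p : plane R => a * \1_V p)).
  exact: (integrableZl measurableT a oneVi).
have bi : (@torus_vol R).-integrable [set: plane R] (EFin \o cst b).
  exact: finite_measure_integrable_cst.
have gi : (@torus_vol R).-integrable [set: plane R]
    (EFin \o (fun p : plane R => a * \1_V p + b)).
  exact: (integrableD measurableT Vi bi).
have -> : a * fine (torus_vol V) + b =
    (\int[@torus_vol R]_p (a * \1_V p + b))%R.
  rewrite RintegralD// RintegralZl// Rintegral_cst//= torus_volT /= mulr1.
  by congr (_ * _ + _); rewrite /Rintegral integral_indic// setIT.
have sq0 : torus_vol (~` @unit_square R) = 0%E.
  by rewrite /torus_vol /mrestr setICl measure0.
rewrite /torus_int /Rintegral.
rewrite !(@integral_conull _ _ _ (@torus_vol R) (@unit_square R))//.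
- by apply: le_Rintegral => //; apply: (integrableS measurableT).
- exact: measurable_int fi.
- exact: measurable_int gi.
Qed.

Lemma torus_integrable_prod {R : realType} (f : R * R -> R) :
  torus_continuous f ->
  (circle_vol R \x circle_vol R)%E.-integrable [set: plane R]
    (EFin \o (f : plane R -> R)).
Proof.
move=> /torus_continuous_integrable/integrableP[mf loo].
apply/integrableP; split; first exact: mf.
apply: le_lt_trans loo.
rewrite le_eqVlt; apply/orP; left; apply/eqP.
by apply: eq_measure_integral => A mA _; have := torus_volE A mA.
Qed.

Lemma torus_int_prod {R : realType} (f : R * R -> R) :
  torus_int f = fine (\int[circle_vol R \x circle_vol R]_p (f p)%:E)%E.
Proof.
rewrite /torus_int /Rintegral; congr fine.
by apply: eq_measure_integral => A mA _; have := torus_volE A mA.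
Qed.

(** Fubini: the integral vanishes as soon as all the integrals over horizontal
    circles do. *)
Lemma torus_int_iter1 {R : realType} (f : R * R -> R) : torus_continuous f ->
  (forall y, (\int[circle_vol R]_x (f (x, y))%:E = 0)%E) -> torus_int f = 0.
Proof.
move=> tf h.
have fi := torus_integrable_prod f tf.
rewrite torus_int_prod -(integral21_prod_meas1 fi)//.
rewrite (eq_integral (cst 0%E)) ?integral0// => z _; exact: h.
Qed.

(** The same with vertical circles. *)
Lemma torus_int_iter2 {R : realType} (f : R * R -> R) : torus_continuous f ->
  (forall x, (\int[circle_vol R]_y (f (x, y))%:E = 0)%E) -> torus_int f = 0.
Proof.
move=> tf h.
have fi := torus_integrable_prod f tf.
rewrite torus_int_prod -(integral12_prod_meas1 fi)//.
rewrite (eq_integral (cst 0%E)) ?integral0// => z _; exact: h.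
Qed.

(** * Fourier coefficients and the uniqueness theorem *)

Lemma cosD2pi_int {R : realType} (z : int) (x : R) :
  cos (x + 2 * pi * z%:~R) = cos x.
Proof.
have nat_case n y : cos (y + 2 * pi * n%:R) = cos y :> R.
  rewrite -[RHS](periodicn (@cosD2pi R) n); congr cos.
  by rewrite -mulr_natr -(mulr_natr pi 2); ring.
case: z => n; first exact: nat_case.
rewrite -[LHS](nat_case n.+1) NegzE intrN; congr cos; ring.
Qed.

(** The real plane waves, with an arbitrary phase: the family contains both the
    cosines (phase 0) and the sines (phase - pi / 2). *)
Definition wave {R : realType} (k l : int) (c : R) (p : R * R) : R :=
  cos (2 * pi * (k%:~R * p.1 + l%:~R * p.2) + c).

Lemma torus_continuous_wave {R : realType} (k l : int) (c : R) :
  torus_continuous (wave k l c).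
Proof.
split=> [p|x y m n].
  apply: (@continuous_comp _ _ _
    (fun p : R * R => 2 * pi * (k%:~R * p.1 + l%:~R * p.2) + c) cos);
    last exact: continuous_cos.
  apply: cvgD; last exact: cvg_cst.
  apply: cvgM; first exact: cvg_cst.
  by apply: cvgD; (apply: cvgM; first exact: cvg_cst);
    [exact: cvg_fst|exact: cvg_snd].
rewrite /wave /= -[RHS](cosD2pi_int (k * m + l * n)); congr cos.
by rewrite intrD !intrM; ring.
Qed.

Lemma wave_translate {R : realType} (k l : int) (c : R) (s p : R * R) :
  wave k l c (p.1 + s.1, p.2 + s.2) =
  wave k l (c + 2 * pi * (k%:~R * s.1 + l%:~R * s.2)) p.
Proof. by rewrite /wave /=; congr cos; ring. Qed.

Lemma waveM {R : realType} (k l k' l' : int) (c c' : R) (p : R * R) :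
  wave k l c p * wave k' l' c' p =
  2^-1 * wave (k + k') (l + l') (c + c') p +
  2^-1 * wave (k - k') (l - l') (c - c') p.
Proof.
pose a := 2 * pi * (k%:~R * p.1 + l%:~R * p.2) + c.
pose b := 2 * pi * (k'%:~R * p.1 + l'%:~R * p.2) + c'.
have -> : wave (k + k') (l + l') (c + c') p = cos (a + b).
  by rewrite /wave !intrD; congr cos; rewrite /a /b; ring.
have -> : wave (k - k') (l - l') (c - c') p = cos (a - b).
  by rewrite /wave !(intrD, intrN); congr cos; rewrite /a /b; ring.
by rewrite /wave -/a -/b (cosD a b) (cosB a b); field.
Qed.

(** [f] is continuous on the torus and all its Fourier coefficients vanish. *)
Definition fourier_null {R : realType} (f : R * R -> R) :=
  torus_continuous f /\
  forall k l (c : R), torus_int (fun p => f p * wave k l c p) = 0.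

Lemma fourier_nullD {R : realType} (f g : R * R -> R) :
  fourier_null f -> fourier_null g -> fourier_null (fun p => f p + g p).
Proof.
move=> [tf hf] [tg hg]; split=> [|k l c]; first exact: torus_continuousD.
have tw := torus_continuous_wave k l c.
under [X in torus_int X]eq_fun do rewrite mulrDl.
by rewrite torus_intD ?hf ?hg ?addr0//; exact: torus_continuousM.
Qed.

Lemma fourier_nullZ {R : realType} (a : R) (f : R * R -> R) :
  fourier_null f -> fourier_null (fun p => a * f p).
Proof.
move=> [tf hf]; split=> [|k l c].
  by apply: torus_continuousM => //; exact: torus_continuous_cst.
have tw := torus_continuous_wave k l c.
under [X in torus_int X]eq_fun do rewrite -mulrA.
by rewrite torus_intZ ?hf ?mulr0//; exact: torus_continuousM.
Qed.

(** A product of two waves is a sum of two waves, so vanishing of all Fourier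
    coefficients is stable under multiplication by a wave. *)
Lemma fourier_null_wave {R : realType} (k l : int) (c : R) (f : R * R -> R) :
  fourier_null f -> fourier_null (fun p => f p * wave k l c p).
Proof.
move=> [tf hf]; split=> [|k' l' c'].
  by apply: torus_continuousM => //; exact: torus_continuous_wave.
have tw k1 l1 (c1 : R) := torus_continuous_wave k1 l1 c1.
under [X in torus_int X]eq_fun do
  rewrite -mulrA waveM mulrDr !(mulrCA (f _) 2^-1).
rewrite torus_intD; first by rewrite !torus_intZ ?hf ?mulr0 ?addr0//;
  exact: torus_continuousM.
all: apply: torus_continuousM; first exact: torus_continuous_cst.
all: exact: torus_continuousM.
Qed.

Lemma fourier_null_translate {R : realType} (s : R * R) (f : R * R -> R) :
  fourier_null f -> fourier_null (fun p => f (p.1 + s.1, p.2 + s.2)).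
Proof.
move=> [tf hf]; split=> [|k l c]; first exact: torus_continuous_translate.
pose c' := c - 2 * pi * (k%:~R * s.1 + l%:~R * s.2).
pose g p := f p * wave k l c' p.
rewrite -(hf k l c') -(torus_int_translate g s); last first.
  by apply: torus_continuousM => //; exact: torus_continuous_wave.
congr torus_int; apply/funext => p; rewrite /g wave_translate.
by congr (_ * wave _ _ _ _); rewrite /c'; ring.
Qed.

(** [peak (x, y)] is [sin (pi x) ^ 2 * sin (pi y) ^ 2], written with waves. On the
    unit square its powers concentrate at the centre. *)
Definition peak {R : realType} (p : R * R) : R :=
  (2^-1 * (1 + wave 1 0 pi p)) * (2^-1 * (1 + wave 0 1 pi p)).

Lemma peakE {R : realType} (p : R * R) :
  peak p =
  (2^-1 * (1 - cos (2 * pi * p.1))) * (2^-1 * (1 - cos (2 * pi * p.2))).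
Proof.
by rewrite /peak /wave !mul1r !mul0r addr0 add0r !(@cosDpi R).
Qed.

Lemma fourier_null_peak {R : realType} (f : R * R -> R) n :
  fourier_null f -> fourier_null (fun p => f p * peak p ^+ n).
Proof.
move=> hf; elim: n => [|n IH].
  by under [X in fourier_null X]eq_fun do rewrite expr0 mulr1.
have half (k l : int) g : fourier_null g ->
    fourier_null (fun p : R * R => g p * (2^-1 * (1 + wave k l pi p))).
  move=> hg; under [X in fourier_null X]eq_fun do rewrite mulrCA mulrDr mulr1.
  by apply: fourier_nullZ; apply: fourier_nullD => //; exact: fourier_null_wave.
have := half 0 1 _ (half 1 0 _ IH); congr fourier_null; apply/funext => p.
by rewrite exprSr /peak !mulrA.
Qed.

Lemma peak_bounds {R : realType} (p : R * R) : 0 <= peak p <= 1.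
Proof.
have h (x : R) : 0 <= 2^-1 * (1 - cos x) <= 1.
  by have := cos_le1 x; have := cos_geN1 x => ? ?; apply/andP; split; lra.
rewrite peakE; have /andP[a0 a1] := h (2 * pi * p.1).
have /andP[b0 b1] := h (2 * pi * p.2).
by rewrite mulr_ge0//= mulr_ile1.
Qed.

(** Away from the centre of the unit square, [peak] is bounded away from 1. *)
Lemma peak_far {R : realType} (d : R) : 0 < d < 2^-1 ->
  exists2 q : R, 0 < q < 1 & forall p, unit_square p ->
    ~ ball ((2^-1, 2^-1) : R * R) d p -> peak p <= q.
Proof.
move=> /andP[d0 d2].
have pi0 := @pi_gt0 R.
exists (2^-1 * (1 + cos (2 * pi * d))).
  have c1 : cos (2 * pi * d) < 1.
    rewrite -[ltRHS](@cos0 R) ltr_cos ?in_itv/= ?lexx ?pi_ge0 ?mulr_gt0//.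
    by apply/andP; split; nra.
  have c2 : -1 < cos (2 * pi * d).
    rewrite -(@cospi R) ltr_cos ?in_itv/= ?lexx ?pi_ge0//; first by nra.
    by apply/andP; split; nra.
  by apply/andP; split; lra.
have far (x : R) : 0 <= x < 1 -> d <= `|2^-1 - x| ->
    2^-1 * (1 - cos (2 * pi * x)) <= 2^-1 * (1 + cos (2 * pi * d)).
  move=> x01 dx; rewrite ler_pM2l// lerD2l.
  (* With [u = 1/2 - x], [- cos (2 pi x) = cos (2 pi `|u|)]. *)
  have -> : - cos (2 * pi * x) = cos (2 * pi * `|2^-1 - x|).
    have -> : 2 * pi * `|2^-1 - x| = `|pi - 2 * pi * x|.
      rewrite -(@ger0_norm _ (2 * pi)) ?mulr_ge0 ?pi_ge0// -normrM.
      rewrite (@ger0_norm _ (2 * pi)) ?mulr_ge0 ?pi_ge0//.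
      by congr (`|_|); field.
    by rewrite cos_norm cosB cospi sinpi mul0r addr0 mulN1r.
  have x2 : `|2^-1 - x| <= 2^-1 by rewrite ler_norml; apply/andP; split; lra.
  rewrite leNgt ltr_cos ?in_itv/= -?leNgt.
  - by rewrite ler_pM2l// mulr_gt0.
  - by apply/andP; split; nra.
  - by rewrite mulr_ge0 ?mulr_ge0 ?pi_ge0//=; nra.
have h (x : R) : 0 <= 2^-1 * (1 - cos x) <= 1.
  by have := cos_le1 x; have := cos_geN1 x => ? ?; apply/andP; split; lra.
move=> [x y] [/= x01 y01] nb; rewrite peakE /=.
have /andP[a0 a1] := h (2 * pi * x).
have /andP[b0 b1] := h (2 * pi * y).
have [dx | dx] := leP d `|2^-1 - x|.
  have := far x _ dx; rewrite in_itv in x01; move/(_ x01) => hx; nra.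
have [dy | dy] := leP d `|2^-1 - y|.
  have := far y _ dy; rewrite in_itv in y01; move/(_ y01) => hy; nra.
by exfalso; apply: nb; split.
Qed.

(** Near the centre, [peak] exceeds any [r < 1] on a set of positive volume. *)
Lemma peak_near {R : realType} (d r : R) : 0 < d -> d < 2^-1 -> r < 1 ->
  exists V : set (plane R), [/\ measurable V, 0 < fine (torus_vol V),
    V `<=` ball ((2^-1, 2^-1) : R * R) d & forall p, V p -> r <= peak p].
Proof.
move=> d0 d2 r1.
pose c : R * R := (2^-1, 2^-1).
have pc : peak c = 1.
  rewrite peakE /= (_ : 2 * pi * 2^-1 = pi); last by field.
  by rewrite cospi; field.
have cp : {for c, continuous (@peak R)}.
  have half k l :
      torus_continuous (fun p : R * R => 2^-1 * (1 + wave k l pi p)).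
    apply: torus_continuousM; first exact: torus_continuous_cst.
    apply: torus_continuousD; first exact: torus_continuous_cst.
    exact: torus_continuous_wave.
  exact: (proj1 (torus_continuousM _ _ (half 1 0) (half 0 1)) c).
have : \forall p \near c, r < peak p.
  by apply: (cvgr_gt _ cp); rewrite pc.
move=> /nbhs_ballP[e /= e0 he].
pose t := Num.min e d.
have t0 : 0 < t by rewrite lt_min e0.
have td : t <= d by rewrite ge_min lexx orbT.
have mB : measurable (ball (2^-1 : R) t : set (measurableTypeR R)).
  exact: measurable_ball.
exists (ball (2^-1 : R) t `*` ball (2^-1 : R) t); split.
- exact: measurableX.
- rewrite torus_volE; last exact: measurableX.
  rewrite product_measure1E//.
  have cb : circle_vol R (ball (2^-1 : R) t) = (t *+ 2)%:E.
    rewrite circle_volE setIidl; first by rewrite lebesgue_measure_ball// ltW.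
    move=> x; rewrite /ball /= ltr_norml in_itv /= => /andP[? ?].
    by apply/andP; split; lra.
  rewrite (_ : (_ * _)%E = (t *+ 2)%:E * (t *+ 2)%:E)%E; last first.
    by congr (_ * _)%E; exact: cb.
  by rewrite -EFinM /= mulr_gt0// pmulrn_lgt0.
- by move=> p [p1 p2]; split; exact: le_ball td _ _.
- move=> p [p1 p2]; apply/ltW/he; split; apply: le_ball; try eassumption.
  all: by rewrite ge_min lexx.
Qed.

(** Uniqueness theorem: a continuous function on the torus is determined by its
    Fourier coefficients. *)
Lemma fourier_null_eq0 {R : realType} (f : R * R -> R) :
  fourier_null f -> forall p, f p = 0.
Proof.
move=> nf p0; apply/eqP/negP => /negP fp0.
wlog fp : f nf fp0 / 0 < f p0 => [hw|].
  have [|fneg|f0] := ltrgt0P (f p0); first exact: hw.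
    apply: (hw (fun p => -1 * f p)); first exact: fourier_nullZ.
      by rewrite mulN1r oppr_eq0.
    by rewrite mulN1r oppr_gt0.
  by rewrite f0 eqxx in fp0.
pose c : R * R := (2^-1, 2^-1).
pose g p := f (p.1 + (p0 - c).1, p.2 + (p0 - c).2).
have ng : fourier_null g by exact: fourier_null_translate.
have gc : g c = f p0.
  by rewrite /g /= !(addrC 2^-1) !subrK -surjective_pairing.
set a := f p0 in fp gc.
have [M hM] := torus_continuous_bounded g (proj1 ng).
have M0 : 0 <= M := le_trans (normr_ge0 _) (hM c).
have : \forall p \near c, a / 2 < g p.
  apply: (cvgr_gt _ (proj1 (proj1 ng) c)); rewrite gc.
  by rewrite ltr_pdivrMr// ltr_pMr// ltr1n.
move=> /nbhs_ballP[e /= e0 he].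
pose d := Num.min e (4^-1).
have d0 : 0 < d by rewrite lt_min e0 invr_gt0 ltr0n.
have d4 : d <= 4^-1 by rewrite ge_min lexx orbT.
have d2 : d < 2^-1 by lra.
have [|q /andP[q0 q1] hq] := peak_far d; first by rewrite d0 d2.
(* The powers of [peak] are at least [r ^+ n] on [V] and at most [q ^+ n] far
   from the centre, with [q < r]: the mass near the centre dominates. *)
pose r := (1 + q) / 2.
have r1 : r < 1 by rewrite /r; lra.
have qr : q < r by rewrite /r; lra.
have r0 : 0 < r by lra.
have [V [mV v0 Vd Vr]] := peak_near d r d0 d2 r1.
set v := fine _ in v0.
have gd p : ball c d p -> a / 2 < g p.
  by move=> cp; apply: he; apply: le_ball cp; rewrite ge_min lexx.
have key n : a / 2 * v <= M * (q / r) ^+ n.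
  have tpn : torus_continuous (fun p => g p * peak p ^+ n).
    exact: (proj1 (fourier_null_peak g n ng)).
  have := torus_int_le (fun p => g p * peak p ^+ n) (a / 2 * r ^+ n)
    (- (M * q ^+ n)) V tpn mV.
  have -> : torus_int (fun p => g p * peak p ^+ n) = 0.
    have := proj2 (fourier_null_peak g n ng) 0 0 0.
    by under [X in torus_int X]eq_fun do
      rewrite /wave !mulr0z !mul0r !addr0 mulr0 cos0 mulr1.
  move=> H; suff /H {H} : forall p, unit_square p ->
      a / 2 * r ^+ n * \1_V p + - (M * q ^+ n) <= g p * peak p ^+ n.
    rewrite -/v subr_le0 => le0.
    have rn : 0 < r ^+ n by rewrite exprn_gt0.
    rewrite expr_div_n [leRHS]mulrA (ler_pdivlMr _ _ rn).
    by rewrite mulrAC.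
  move=> p sp.
  have /andP[k0 k1] := peak_bounds p.
  have Mq : 0 <= M * q ^+ n by rewrite mulr_ge0// exprn_ge0// ltW.
  have [cp|ncp] := pselect (ball c d p).
    have gp := gd p cp.
    have pn0 : 0 <= peak p ^+ n by rewrite exprn_ge0.
    rewrite indicE; have [/set_mem Vp|nV] := boolP (p \in V).
      have : r ^+ n <= peak p ^+ n by rewrite lerXn2r ?nnegrE ?(ltW r0)// Vr.
      have : 0 <= r ^+ n by rewrite exprn_ge0// ltW.
      by rewrite mulr1; nra.
    by rewrite mulr0 add0r; nra.
  have pq : peak p ^+ n <= q ^+ n.
    by rewrite lerXn2r ?nnegrE ?(ltW q0)// hq.
  rewrite indicE memNset; last by move=> /Vd.
  rewrite mulr0 add0r lerNl; apply: le_trans (ler_norm _) _.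
  rewrite normrN normrM (ger0_norm (exprn_ge0 _ k0)).
  by rewrite ler_pM// exprn_ge0.
have : (fun n => M * (q / r) ^+ n) @ \oo --> (0 : R).
  rewrite -(mulr0 M); apply: cvgM; first exact: cvg_cst.
  apply: cvg_expr; rewrite ger0_norm.
    by rewrite (ltr_pdivrMr _ _ r0) mul1r.
  by rewrite divr_ge0// ltW.
move=> /cvgr_lt /(_ (a / 2 * v)) [|N _ /(_ N (leqnn _))].
  by rewrite mulr_gt0// divr_gt0.
by rewrite ltNge key.
Qed.

(** * Fourier coefficients of an eigenfunction *)

Lemma pderiv1_periodic {R : realType} (f : R * R -> R) :
  Z2_periodic f -> Z2_periodic (pderiv1 f).
Proof.
move=> pf x y m n; rewrite /pderiv1 /derive pf.
under eq_fun => h.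
  rewrite /= (_ : _ + (x + m%:~R, y + n%:~R) =
    ((h *: ((1, 0) : R * R)).1 + x + m%:~R,
     (h *: ((1, 0) : R * R)).2 + y + n%:~R)); last first.
    by rewrite -!addrA.
  rewrite pf; over.
by [].
Qed.

Lemma pderiv2_periodic {R : realType} (f : R * R -> R) :
  Z2_periodic f -> Z2_periodic (pderiv2 f).
Proof.
move=> pf x y m n; rewrite /pderiv2 /derive pf.
under eq_fun => h.
  rewrite /= (_ : _ + (x + m%:~R, y + n%:~R) =
    ((h *: ((0, 1) : R * R)).1 + x + m%:~R,
     (h *: ((0, 1) : R * R)).2 + y + n%:~R)); last first.
    by rewrite -!addrA.
  rewrite pf; over.
by [].
Qed.

Lemma is_derive_slice1 {R : realType} (f : R * R -> R) (x y : R) :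
  derivable f (x, y) (1, 0) ->
  is_derive x 1 (fun t : R => f (t, y)) (pderiv1 f (x, y)).
Proof.
have E : (fun h : R => h^-1 *:
      (((fun t : R => f (t, y)) \o shift x) (h *: 1) - f (x, y))) =
    (fun h : R => h^-1 *:
      ((f \o shift (x, y)) (h *: ((1, 0) : R * R)) - f (x, y))).
  apply/funext => h /=; congr (_ *: (f _ - _)).
  by rewrite -[RHS]/(h *: (1 : R) + x, h *: (0 : R) + y) scaler0 add0r.
by move=> df; apply: DeriveDef; rewrite /pderiv1 /derivable /derive E.
Qed.

Lemma is_derive_slice2 {R : realType} (f : R * R -> R) (x y : R) :
  derivable f (x, y) (0, 1) ->
  is_derive y 1 (fun t : R => f (x, t)) (pderiv2 f (x, y)).
Proof.
have E : (fun h : R => h^-1 *: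
      (((fun t : R => f (x, t)) \o shift y) (h *: 1) - f (x, y))) =
    (fun h : R => h^-1 *:
      ((f \o shift (x, y)) (h *: ((0, 1) : R * R)) - f (x, y))).
  apply/funext => h /=; congr (_ *: (f _ - _)).
  by rewrite -[RHS]/(h *: (0 : R) + x, h *: (1 : R) + y) scaler0 add0r.
by move=> df; apply: DeriveDef; rewrite /pderiv2 /derivable /derive E.
Qed.

(** Two integrations by parts over a period, against a solution
    [cos (a x + b)] of [w'' = - a ^ 2 w] of the same period. *)
Lemma circle_green {R : realType} (u u1 u2 : R -> R) (k : int) (b : R) :
  (forall x : R, is_derive x 1 u (u1 x)) ->
  (forall x : R, is_derive x 1 u1 (u2 x)) ->
  u 1 = u 0 -> u1 1 = u1 0 -> continuous u2 ->
  (\int[circle_vol R]_x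
     ((u2 x + (2 * pi * k%:~R) ^+ 2 * u x) * cos (2 * pi * k%:~R * x + b))%:E
   = 0)%E.
Proof.
move=> du du1 pu pu1 cu2; set a := 2 * pi * k%:~R.
have dcont (g g' : R -> R) :
    (forall x : R, is_derive x 1 g (g' x)) -> continuous g.
  move=> dg x; apply: differentiable_continuous; apply/derivable1_diffP.
  by case: (dg x).
have dl (x : R) : is_derive x 1 (fun x : R => a * x + b) a.
  apply: is_derive_eq (is_deriveD (is_deriveZ a (is_derive_id x 1))
    (is_derive_cst b x 1)) _.
  by rewrite addr0 /GRing.scale /= mulr1.
have dc (x : R) :
    is_derive x 1 (fun x : R => cos (a * x + b)) (- sin (a * x + b) * a).
  exact: is_derive1_comp (is_derive_cos _) (dl x).
have ds (x : R) :
    is_derive x 1 (fun x : R => sin (a * x + b)) (cos (a * x + b) * a).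
  exact: is_derive1_comp (is_derive_sin _) (dl x).
pose F (x : R) := u1 x * cos (a * x + b) + a * (u x * sin (a * x + b)).
pose f (x : R) := (u2 x + a ^+ 2 * u x) * cos (a * x + b).
have dF (x : R) : is_derive x 1 F (f x).
  apply: is_derive_eq (is_deriveD (is_deriveM (du1 x) (dc x))
    (is_deriveZ a (is_deriveM (du x) (ds x)))) _.
  by rewrite /f /GRing.scale /=; ring.
have cf : continuous f.
  move=> x; apply: cvgM; last exact: dcont dc x.
  apply: cvgD; first exact: cu2.
  apply: cvgM; [exact: cvg_cst|exact: dcont du x].
have FE (x : R) : derive1 F x = f x by rewrite derive1E; case: (dF x).
have cF := dcont _ _ dF.
rewrite circle_integralE// (@continuous_FTC2 R f F 0 1)//.
- have c10 : cos (a * 1 + b) = cos (a * 0 + b).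
    by rewrite mulr1 mulr0 add0r addrC cosD2pi_int.
  have s10 : sin (a * 1 + b) = sin (a * 0 + b).
    by rewrite -!cosBpihalf mulr1 mulr0 add0r -addrA addrC cosD2pi_int.
  by rewrite -EFinB /F pu pu1 c10 s10 subrr.
- exact: continuous_subspaceT.
- split; last 2 first.
  + exact: cvg_at_right_filter (cF 0).
  + exact: cvg_at_left_filter (cF 1).
  + by move=> x _; case: (dF x).
Qed.

(** Green's formula in the first variable. *)
Lemma torus_green1 {R : realType} (f : R * R -> R) (k l : int) (c : R) :
  Z2_periodic f -> class_C 2 f ->
  torus_int (fun p => (pderiv1 (pderiv1 f) p + (2 * pi * k%:~R) ^+ 2 * f p)
                      * wave k l c p) = 0.
Proof.
move=> pf [cf [d1 _ [c1 [d11 _ [c11 _] _]] _]].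
have p1 := pderiv1_periodic f pf.
have p11 := pderiv1_periodic _ p1.
apply: torus_int_iter1.
  apply: torus_continuousM; last exact: torus_continuous_wave.
  apply: torus_continuousD => //; apply: torus_continuousM => //.
  exact: torus_continuous_cst.
move=> y; rewrite -[RHS](@circle_green R (fun x => f (x, y))
  (fun x => pderiv1 f (x, y)) (fun x => pderiv1 (pderiv1 f) (x, y)) k
  (2 * pi * (l%:~R * y) + c)).
- apply: eq_integral => x _; congr (_ * cos _)%:E; rewrite /=; ring.
- by move=> x; exact: is_derive_slice1.
- by move=> x; exact: is_derive_slice1.
- by have := pf 0 y 1 0; rewrite add0r addr0.
- by have := p1 0 y 1 0; rewrite add0r addr0.
- move=> x; apply: (@continuous_comp _ _ _ (fun x : R => (x, y)));
    last exact: c11.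
  by apply: (@cvg_pair _ _ _ (nbhs x) (nbhs x) (nbhs y));
    [exact: cvg_id|exact: cvg_cst].
Qed.

(** Green's formula in the second variable. *)
Lemma torus_green2 {R : realType} (f : R * R -> R) (k l : int) (c : R) :
  Z2_periodic f -> class_C 2 f ->
  torus_int (fun p => (pderiv2 (pderiv2 f) p + (2 * pi * l%:~R) ^+ 2 * f p)
                      * wave k l c p) = 0.
Proof.
move=> pf [cf [_ d2 _ [c2 [_ d22 _ [c22 _]]]]].
have p2 := pderiv2_periodic f pf.
have p22 := pderiv2_periodic _ p2.
apply: torus_int_iter2.
  apply: torus_continuousM; last exact: torus_continuous_wave.
  apply: torus_continuousD => //; apply: torus_continuousM => //.
  exact: torus_continuous_cst.
move=> x; rewrite -[RHS](@circle_green R (fun y => f (x, y))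
  (fun y => pderiv2 f (x, y)) (fun y => pderiv2 (pderiv2 f) (x, y)) l
  (2 * pi * (k%:~R * x) + c)).
- apply: eq_integral => y _; congr (_ * cos _)%:E; rewrite /=; ring.
- by move=> y; exact: is_derive_slice2.
- by move=> y; exact: is_derive_slice2.
- by have := pf x 0 0 1; rewrite add0r addr0.
- by have := p2 x 0 0 1; rewrite add0r addr0.
- move=> y; apply: (@continuous_comp _ _ _ (fun y : R => (x, y)));
    last exact: c22.
  by apply: (@cvg_pair _ _ _ (nbhs y) (nbhs x) (nbhs y));
    [exact: cvg_cst|exact: cvg_id].
Qed.

Lemma torus_smooth_continuous {R : realType} (psi : torus_smooth R) :
  torus_continuous psi.
Proof.
exact: conj (proj1 (torus_fun_smooth psi 0)) (torus_fun_periodic psi).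
Qed.

(** The coefficients of an eigenfunction live on a single circle. *)
Lemma eigenfunction_coef {R : realType} (psi : torus_smooth R) (mu : R)
    (k l : int) (c : R) :
  (forall p, - laplacian psi p = mu * psi p) ->
  torus_int (fun p => psi p * wave k l c p) != 0 ->
  mu = (2 * pi) ^+ 2 * (k ^+ 2 + l ^+ 2)%:~R.
Proof.
move=> eig nz.
have pf := torus_fun_periodic psi.
have C2 := torus_fun_smooth psi 2.
have g1 := torus_green1 psi k l c pf C2.
have g2 := torus_green2 psi k l c pf C2.
have [cf [d1 d2 [c1 [d11 _ [c11 _] _]] [c2 [_ d22 _ [c22 _]]]]] := C2.
have tw := torus_continuous_wave k l c.
have tpsi : torus_continuous psi := conj cf pf.
have tZ (a : R) (g : R * R -> R) : torus_continuous g ->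
    torus_continuous (fun p => a * g p).
  by move=> ?; apply: torus_continuousM => //; exact: torus_continuous_cst.
have t11 : torus_continuous (pderiv1 (pderiv1 psi)).
  exact: (conj c11 (pderiv1_periodic _ (pderiv1_periodic _ pf))).
have t22 : torus_continuous (pderiv2 (pderiv2 psi)).
  exact: (conj c22 (pderiv2_periodic _ (pderiv2_periodic _ pf))).
have : torus_int (fun p => ((2 * pi) ^+ 2 * (k ^+ 2 + l ^+ 2)%:~R - mu) *
    (psi p * wave k l c p)) = 0.
  rewrite -[RHS](addr0 0) -{1}g1 -g2 -torus_intD.
  - congr torus_int; apply/funext => p.
    have -> : pderiv1 (pderiv1 psi) p =
        - (mu * psi p) - pderiv2 (pderiv2 psi) p.
      by rewrite -eig /laplacian; ring.
    by rewrite !(intrD, intrM, expr2); ring.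
  - by apply: torus_continuousM => //; apply: torus_continuousD => //; exact: tZ.
  - by apply: torus_continuousM => //; apply: torus_continuousD => //; exact: tZ.
rewrite torus_intZ; last exact: torus_continuousM.
by move/eqP; rewrite mulf_eq0 (negbTE nz) orbF subr_eq0 => /eqP.
Qed.

(** * Antiperiodicity of eigenfunctions *)

(** A translation that changes the sign of all waves on a given circle. *)
Lemma half_period_wave {R : realType} (n : nat) : (0 < n)%N ->
  exists s : R * R, forall (k l : int), k ^+ 2 + l ^+ 2 = n%:Z ->
    forall c p, wave k l c (p.1 + s.1, p.2 + s.2) = - wave k l c p.
Proof.
move=> /(half_period R)[s hs]; exists s => k l /hs[z hz] c p.
rewrite wave_translate hz /wave.
rewrite -(@cosDpi R) -[RHS](cosD2pi_int z); congr cos; by field.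
Qed.

Lemma sqr_norm_gt0 (k l : int) : (k, l) != (0, 0) ->
  exists2 n : nat, (0 < n)%N & k ^+ 2 + l ^+ 2 = n%:Z.
Proof.
move=> kl0; have h : 0 < k ^+ 2 + l ^+ 2.
  rewrite lt0r addr_ge0 ?sqr_ge0// andbT paddr_eq0 ?sqr_ge0// !sqrf_eq0.
  by move: kl0; rewrite xpair_eqE.
by move: h; case: (k ^+ 2 + l ^+ 2) => // n n0; exists n.
Qed.

(** A nonconstant wave has mean zero, since a translation changes its sign. *)
Lemma torus_int_wave {R : realType} (k l : int) (c : R) :
  (k, l) != (0, 0) -> torus_int (wave k l c) = 0.
Proof.
move=> /sqr_norm_gt0[n n0 nE].
have [s hs] := @half_period_wave R n n0.
have tw := torus_continuous_wave k l c.
have := torus_int_translate (wave k l c) s tw.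
under [X in torus_int X]eq_fun do rewrite (hs _ _ nE) -mulN1r.
by rewrite torus_intZ//; lra.
Qed.

(** A nonconstant function has a nonzero coefficient away from the origin:
    otherwise the function minus its mean would have no nonzero coefficient. *)
Lemma nonconstant_coef {R : realType} (f : R * R -> R) : torus_continuous f ->
  ~ (exists c : R, forall p, f p = c) ->
  exists k l (c : R), (k, l) != (0, 0) /\
    torus_int (fun p => f p * wave k l c p) != 0.
Proof.
move=> tf nc; apply: contrapT => nex; apply: nc; exists (torus_int f) => p.
pose m := torus_int f.
have tw k l c : torus_continuous (wave k l c : R * R -> R).
  exact: torus_continuous_wave.
suff /fourier_null_eq0 /(_ p) : fourier_null (fun p => f p + - m).
  by move/eqP; rewrite subr_eq0 => /eqP.
split=> [|k l c]; first exact: torus_continuousD (torus_continuous_cst _).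
under [X in torus_int X]eq_fun do rewrite mulrDl.
rewrite torus_intD; [|exact: torus_continuousM|
  by apply: torus_continuousM => //; exact: torus_continuous_cst].
rewrite torus_intZ//.
have [[-> ->]|kl0] := eqVneq (k, l) (0, 0).
  have wc : wave 0 0 c = fun=> cos c :> R.
    by apply/funext => q; rewrite /wave !mulr0z !mul0r addr0 mulr0 add0r.
  rewrite wc torus_int_cst.
  under [X in torus_int X]eq_fun do rewrite mulrC.
  by rewrite torus_intZ// -/m; ring.
rewrite torus_int_wave// mulr0 addr0; apply/eqP/negP => /negP h.
by apply: nex; exists k, l, c.
Qed.

(** A half period of the circle of frequencies is an antiperiod. *)
Lemma eigenfunction_antiperiodic {R : realType} (psi : torus_smooth R) :
  real_eigenfunction psi -> ~ (exists c : R, forall p, psi p = c) ->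
  exists s : R * R, forall p, psi (p.1 + s.1, p.2 + s.2) = - psi p.
Proof.
move=> [_ [mu eig]] nc.
have tpsi := torus_smooth_continuous psi.
have [k0 [l0 [c0 [kl0 h0]]]] := nonconstant_coef psi tpsi nc.
have [n n0 nE] := sqr_norm_gt0 k0 l0 kl0.
have muE := eigenfunction_coef psi mu k0 l0 c0 eig h0.
have [s hs] := @half_period_wave R n n0.
exists s.
have tpsis := torus_continuous_translate psi s tpsi.
suff nul : fourier_null (fun p => psi (p.1 + s.1, p.2 + s.2) + psi p).
  move=> p; apply/eqP; rewrite -addr_eq0; apply/eqP.
  exact: fourier_null_eq0 nul p.
split=> [|k l c]; first exact: torus_continuousD.
have tw k1 l1 c1 : torus_continuous (wave k1 l1 c1 : R * R -> R).
  exact: torus_continuous_wave.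
under [X in torus_int X]eq_fun do rewrite mulrDl.
rewrite torus_intD; [|exact: torus_continuousM|exact: torus_continuousM].
have coef0 c' : k ^+ 2 + l ^+ 2 != n%:Z ->
    torus_int (fun p => psi p * wave k l c' p) = 0.
  move=> kln; apply/eqP; apply: contraNT kln => h.
  have := eigenfunction_coef psi mu k l c' eig h.
  have pi2 : (2 * pi) ^+ 2 != 0 :> R.
    by rewrite expf_neq0// mulf_neq0// lt0r_neq0// pi_gt0.
  by rewrite muE nE => /(mulfI pi2)/intr_inj ->.
(* Translating [psi] by [s] amounts to translating the wave by [- s], which
   changes its phase into [c']. *)
pose c' := c - 2 * pi * (k%:~R * s.1 + l%:~R * s.2).
have -> : torus_int (fun p => psi (p.1 + s.1, p.2 + s.2) * wave k l c p) =
    torus_int (fun p => psi p * wave k l c' p).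
  rewrite -(torus_int_translate (fun p => psi p * wave k l c' p) s);
    last exact: torus_continuousM.
  congr torus_int; apply/funext => p; rewrite wave_translate.
  by congr (_ * wave _ _ _ _); rewrite /c'; ring.
have [kln|kln] := eqVneq (k ^+ 2 + l ^+ 2) n%:Z; last by rewrite !coef0// addr0.
have wE p : wave k l c' p = -1 * wave k l c p.
  rewrite mulN1r -[LHS]opprK -(hs k l kln) wave_translate.
  by congr (- wave _ _ _ _); rewrite /c'; ring.
under [X in torus_int X + _]eq_fun do rewrite wE mulrCA.
by rewrite torus_intZ; [lra|exact: torus_continuousM].
Qed.

(** * Symmetry of the distribution *)

(** An antiperiodic function is equidistributed with its opposite. *)
Lemma antiperiodic_equidistribution {R : realType} (f : R * R -> R)
    (s : R * R) (A : set (measurableTypeR R)) :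
  torus_continuous f -> (forall p, f (p.1 + s.1, p.2 + s.2) = - f p) ->
  measurable A ->
  torus_vol [set p : plane R | A (- f p)] =
  torus_vol [set p : plane R | A (f p)].
Proof.
move=> [cf pf] fs mA.
have [t [t1 t2] ft] := translate_rotate s.
have mfA : measurable ([set p | A (f p)] : set (plane R)).
  have := continuous_measurable_plane f cf measurableT A mA.
  by rewrite setTI.
rewrite -[RHS](torus_vol_rotate t _ t1 t2 mfA); congr (torus_vol _).
by apply/seteqP; split => p /=; rewrite -(ft f pf) fs.
Qed.

(** The Stieltjes measure of [s |-> - vol {psi > s}] is the image of the volume
    under [psi]. *)
Lemma stieltjes_distribution {R : realType} (psi : torus_smooth R)
    (A : set (measurableTypeR R)) : measurable A ->
  lebesgue_stieltjes_measure (opp_distribution_function psi) A =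
  torus_vol [set p : plane R | A (psi p)].
Proof.
move=> mA.
have mpsi := torus_smooth_measurable psi.
pose nu : {measure set (measurableTypeR R) -> \bar R} :=
  measure_function_pushforward__canonical__measure_function_Measure
    (@torus_vol R) (f := (psi : plane R -> measurableTypeR R)) mpsi.
rewrite (@lebesgue_stieltjes_measure_unique R _ nu)// => _
  /ocitvP[->|[[a b] /= ab ->]].
  by rewrite !measure0.
rewrite /lebesgue_stieltjes_measure /measure_extension.
rewrite measurable_mu_extE/=; last exact: is_ocitv.
rewrite wlength_itv_bnd; last exact: ltW.
rewrite /opp_distribution_function /distribution_function /pushforward.
have mlt (c : R) : measurable ([set p | c < psi p] : set (plane R)).
  have := mpsi measurableT _ (measurable_itv `]c, +oo[).
  rewrite setTI; congr measurable; apply/seteqP.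
  by split => p /=; rewrite in_itv /= andbT.
have mab : measurable (psi @^-1` `]a, b]%classic : set (plane R)).
  by have := mpsi measurableT _ (measurable_itv `]a, b]); rewrite setTI.
have -> : [set p : plane R | a < psi p] =
    psi @^-1` `]a, b]%classic `|` [set p | b < psi p].
  apply/seteqP; split => p /=; rewrite in_itv /=.
    by move=> ->; have [|] := leP (psi p) b; [left|right].
  by move=> [/andP[]//|]; exact: lt_trans.
have mb := mlt b; set B := [set p : plane R | b < psi p] in mb *.
set C := psi @^-1` _ in mab *.
have -> : torus_vol (C `|` B) = (torus_vol C + torus_vol B)%E.
  apply: measureU => //; apply/seteqP; split => p //; rewrite /C /B /= in_itv /=.
  by case=> /andP[_]; rewrite leNgt => /negP.
have fin D : measurable D -> exists v, @torus_vol R D = v%:E.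
  by move=> mD; exists (fine (torus_vol D)); rewrite fineK// fin_num_measure.
have [[v ->] [w ->]] := (fin _ mab, fin _ mb).
by congr _%:E; rewrite /=; ring.
Qed.

Theorem theorem2p3 (R : realType) (psi : torus_smooth R)
    (psi_eigen : real_eigenfunction psi)
    (psi_nonconstant : ~ exists c : R, forall p, psi p = c) :
  symmetric_around0 (dlambda psi) /\
  (forall s : R, torus_vol [set p | s < psi p] = torus_vol [set p | psi p < - s]).
Proof.
have [s hs] := eigenfunction_antiperiodic psi psi_eigen psi_nonconstant.
have tpsi := torus_smooth_continuous psi.
split=> [A mA|t].
  have mNA : measurable ((-%R : R -> R) @^-1` A : set (measurableTypeR R)).
    rewrite -[X in measurable X]setTI.
    by apply: (@measurable_funN _ (measurableTypeR R) R setT id).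
  rewrite /dlambda (stieltjes_distribution psi _ mNA).
  rewrite (stieltjes_distribution psi _ mA); congr (- _)%E.
  exact: antiperiodic_equidistribution hs mA.
have := antiperiodic_equidistribution psi s `]t, +oo[%classic tpsi hs
  (measurable_itv `]t, +oo[).
have -> : [set p : plane R | `]t, +oo[%classic (psi p)] = [set p | t < psi p].
  by apply/seteqP; split => p /=; rewrite in_itv /= andbT.
move=> <-; congr (torus_vol _).
by apply/seteqP; split => p /=; rewrite in_itv /= andbT ltrNr.
Qed.
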